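(* Let $\rho_{AB}$ be a state on finite-dimensional systems $A,B$, let $n\ge1$, and let $A_1,\dots,A_n$ be copies of $A$. Then the optimal unilocal $n$-broadcasting fidelity $f_n(\rho_{AB})$ equals the optimal value of the semidefinite program \[ \begin{aligned} \max\ &\tfrac{1}{2}\mathrm{tr}(X_{AB}+X_{AB}^\dagger)\\ \text{s.t. }&\begin{pmatrix}\rho_{AB} & X_{AB}\\ X_{AB}^\dagger & \mathrm{tr}_{\backslash A_1B}(J^{T_A}\rho_{AB})\end{pmatrix}\ge0,\\ & J_{AA_1\cdots A_n}\ge0,\quad \mathrm{tr}_{A_1\cdots A_n}J_{AA_1\cdots A_n}=\mathbb{1}_A,\\ & J_{AA_1\cdots A_n}=\frac{1}{n!}\sum_{\pi\in S_n}W_\pi J_{AA_1\cdots A_n}W_\pi^\dagger, \end{aligned} \] where the variables are a linear operator $X_{AB}$ and a Hermitian operator $J_{AA_1\cdots A_n}$, $W_\pi$ acts on $A_1\cdots A_n$, and $\mathrm{tr}_{\backslash A_1B}(J^{T_A}\rho_{AB})$ denotes the operator on $A_1B$ obtained by forming $(J^{T_A}\otimes\mathbb{1}_B)(\rho_{AB}\otimes \mathbb{1}_{A_1\cdots A_n})$ and tracing out $A,A_2,\dots,A_n$ (with $A_1$ identified with $A$).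
   Context: Fidelity: $F(\rho,\sigma)=\mathrm{tr}\sqrt{\sqrt{\rho}\sigma\sqrt{\rho}}$. Systems $A_1,\dots,A_n$ are isomorphic to $A$, each with a fixed orthonormal basis $\{|j\rangle\}$. For a quantum channel $\Lambda_{A\to A_1\cdots A_n}$, $\mathrm{tr}_{\backslash A_jB}$ denotes tracing out all systems except $A_j$ and $B$. The optimal unilocal $n$-broadcasting fidelity of $\rho_{AB}$ on $A$ is \[f_n(\rho_{AB})=\sup\Big\{\frac1n\sum_{j=1}^nF\big(\rho_{AB},\mathrm{tr}_{\backslash A_jB}(\Lambda_{A\to A_1\cdots A_n}\otimes\mathrm{id}_B)(\rho_{AB})\big):\ \Lambda \text{ a quantum channel}\Big\},\] with $A_j$ identified with $A$. For a permutation $\pi\in S_n$, $W_\pi$ is the unitary on $A_1\cdots A_n$ with $W_\pi|j_1,\dots,j_n\rangle=|j_{\pi^{-1}(1)},\dots,j_{\pi^{-1}(n)}\rangle$. $T_A$ denotes partial transpose on $A$ in the fixed basis. (For a channel $\Lambda$ its Choi matrix is $J_\Lambda=(\mathrm{id}_{A}\otimes\Lambda)(\sum_{i,j}|ii\rangle\langle jj|)$, and $\Lambda(\rho_A)=\mathrm{tr}_A(J_\Lambda^{T_A}\rho_A)$.) *)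

(* Defs.v *)
From mathcomp Require Import all_boot all_order all_algebra all_fingroup.
From mathcomp Require Import complex.
From mathcomp Require Import classical_sets reals.
From Stdlib Require Import ClassicalEpsilon.

Set Implicit Arguments.
Unset Strict Implicit.
Unset Printing Implicit Defensive.

Import Order.TTheory GRing.Theory Num.Theory.
Local Open Scope ring_scope.

Section QInfo.
Variable R : realType.
Local Notation C := R[i].

(* ---------- operators on a finite-dimensional system ----------
   A system is a finite type T (labels of its fixed orthonormal basis);
   an operator on it is a #|T| x #|T| complex matrix, with rows/columns
   indexed through enum_rank / enum_val. *)
Definition Op (T : finType) := 'M[C]_#|T|.

Definition ent (T : finType) (M : Op T) (x y : T) : C :=
  M (enum_rank x) (enum_rank y).

Definition mkop (T : finType) (f : T -> T -> C) : Op T :=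
  \matrix_(i, j) f (enum_val i) (enum_val j).

Definition adj m p (M : 'M[C]_(m, p)) : 'M[C]_(p, m) := (map_mx Num.conj M)^T.

Definition hermitian m (M : 'M[C]_m) : Prop := adj M = M.

(* positive semidefinite: <v, M v> >= 0 for all v (in C, 0 <= z means
   z is a nonnegative real) *)
Definition psd m (M : 'M[C]_m) : Prop :=
  forall v : 'cV[C]_m, 0 <= ((adj v) *m M *m v) 0 0.

Definition psd_sqrt m (M : 'M[C]_m) : 'M[C]_m :=
  epsilon (inhabits 0) (fun S => psd S /\ S *m S = M).

(* Uhlmann fidelity F(rho,sigma) = tr sqrt(sqrt rho sigma sqrt rho)
   (a nonnegative real number; we take the real part of the trace). *)
Definition fidelity m (rho sigma : 'M[C]_m) : R :=
  complex.Re (\tr (psd_sqrt (psd_sqrt rho *m sigma *m psd_sqrt rho))).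

Definition is_state (T : finType) (rho : Op T) : Prop :=
  psd rho /\ \tr rho = 1.

Definition tens (T1 T2 : finType) (M : Op T1) (N : Op T2) : Op (T1 * T2)%type :=
  mkop (fun x y => ent M x.1 y.1 * ent N x.2 y.2).

Definition ptr1 (T1 T2 : finType) (M : Op (T1 * T2)%type) : Op T2 :=
  mkop (fun x y => \sum_(a : T1) ent M (a, x) (a, y)).

Definition ptr2 (T1 T2 : finType) (M : Op (T1 * T2)%type) : Op T1 :=
  mkop (fun x y => \sum_(b : T2) ent M (x, b) (y, b)).

Definition ptrans1 (T1 T2 : finType) (M : Op (T1 * T2)%type) : Op (T1 * T2)%type :=
  mkop (fun x y => ent M (y.1, x.2) (x.1, y.2)).

Definition reidx (T T' : finType) (f : T' -> T) (M : Op T) : Op T' :=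
  mkop (fun x y => ent M (f x) (f y)).

(* basis labels of A_1 ... A_n : functions 'I_n -> A *)
Definition copies (A : finType) (n : nat) := {ffun 'I_n -> A}.

Definition upd (A : finType) n (g : copies A n) (j : 'I_n) (a : A) : copies A n :=
  [ffun i => if i == j then a else g i].

(* tr_{\ A_j B} : operator on A_1...A_n B -> operator on A_j B, with A_j
   identified with A. *)
Definition red_j (A B : finType) n (j : 'I_n) (M : Op (copies A n * B)%type) : Op (A * B)%type :=
  mkop (fun x y => \sum_(g : copies A n | g j == x.1) ent M (g, x.2) (upd g j y.1, y.2)).

Definition Wperm (A : finType) n (pi : 'S_n) : Op (copies A n) :=
  mkop (fun g h : copies A n => (g == [ffun i => h ((pi^-1)%g i)])%:R).

(* (Lambda \otimes id_K)(M) for a linear map Lambda on operators of A *)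
Definition app_id (A A' K : finType) (L : Op A -> Op A') (M : Op (A * K)%type) :
  Op (A' * K)%type :=
  mkop (fun x y => ent (L (mkop (fun a a' => ent M (a, x.2) (a', y.2)))) x.1 y.1).

Definition channel (A A' : finType) (L : {linear Op A -> Op A'}) : Prop :=
  (forall k (M : Op (A * 'I_k)%type), psd M -> psd (app_id L M)) /\
  (forall M : Op A, \tr (L M) = \tr M).

Definition broadcast_fid (A B : finType) n (rho : Op (A * B)%type) : R :=
  sup [set x : R | exists L : {linear Op A -> Op (copies A n)},
         channel L /\
         x = n%:R^-1 * \sum_(j < n) fidelity rho (red_j j (app_id L rho))].

Definition sdp_Y (A B : finType) n (j1 : 'I_n) (J : Op (A * copies A n)%type)
  (rho : Op (A * B)%type) : Op (A * B)%type :=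
  let P : Op ((A * copies A n) * B)%type :=
    tens (ptrans1 J) (1%:M : Op B) *m
    reidx (fun s : (A * copies A n) * B => ((s.1.1, s.2), s.1.2))
          (tens rho (1%:M : Op (copies A n))) in
  red_j j1 (ptr1 (reidx (fun s : A * (copies A n * B) => ((s.1, s.2.1), s.2.2)) P)).

Definition sdp_feasible (A B : finType) n (j1 : 'I_n) (rho : Op (A * B)%type)
  (X : Op (A * B)%type) (J : Op (A * copies A n)%type) : Prop :=
  psd (block_mx rho X (adj X) (sdp_Y j1 J rho)) /\
  hermitian J /\ psd J /\
  ptr2 J = 1%:M /\
  J = (n`!%:R)^-1 *: \sum_(pi : 'S_n)
        (tens (1%:M : Op A) (Wperm A pi) *m J *m adj (tens (1%:M : Op A) (Wperm A pi))).

Definition sdp_value (A B : finType) n (j1 : 'I_n) (rho : Op (A * B)%type) : R :=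
  sup [set x : R | exists (X : Op (A * B)%type) (J : Op (A * copies A n)%type),
         sdp_feasible j1 rho X J /\
         x = complex.Re (2^-1 * \tr (X + adj X))].

End QInfo.

(* Main.v *)
From HB Require Import structures.
Require Import Defs.
From mathcomp Require Import all_boot all_order all_algebra all_fingroup.
From mathcomp Require Import complex spectral.
From mathcomp Require Import classical_sets reals.
From Stdlib Require Import ClassicalEpsilon.
Import Order.TTheory GRing.Theory Num.Theory.
Local Open Scope ring_scope.

Set Implicit Arguments.
Unset Strict Implicit.
Unset Printing Implicit Defensive.

(** The fidelity F(rho, sigma) is the maximum of Re tr X over the X making
    [[rho, X], [X^dagger, sigma]] positive. Through the Choi isomorphism a
    channel is an operator J >= 0 with partial trace 1, and conjugating J by
    W_pi sends the j-th marginal to the marginal of index pi^-1(j). Hence the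
    average of J over S_n has all its marginals equal to the mean of the n
    marginals of J. Averaging the n optimal block matrices of a channel gives a
    feasible point of the program with the same value; conversely a symmetric J
    has n equal marginals, so its mean fidelity is the fidelity of the first. *)

(** * Positive semidefinite matrices *)

Section PositiveMatrices.
Variable R : realType.
Local Notation C := R[i].

Lemma adjK m p (M : 'M[C]_(m, p)) : adj (adj M) = M.
Proof. by apply/matrixP => i j; rewrite !mxE conjCK. Qed.

Lemma adjM m p q (M : 'M[C]_(m, p)) (N : 'M[C]_(p, q)) :
  adj (M *m N) = adj N *m adj M.
Proof. by rewrite /adj map_mxM trmx_mul. Qed.

Lemma adjD m p (M N : 'M[C]_(m, p)) : adj (M + N) = adj M + adj N.
Proof. by rewrite /adj map_mxD linearD. Qed.

Lemma adjN m p (M : 'M[C]_(m, p)) : adj (- M) = - adj M.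
Proof. by rewrite /adj map_mxN linearN. Qed.

Lemma adjB m p (M N : 'M[C]_(m, p)) : adj (M - N) = adj M - adj N.
Proof. by rewrite adjD adjN. Qed.

Lemma adj_scalemx m p (a : C) (M : 'M[C]_(m, p)) : adj (a *: M) = a^* *: adj M.
Proof. by rewrite /adj map_mxZ linearZ. Qed.

Lemma adj_idmx m : adj (1%:M : 'M[C]_m) = 1%:M.
Proof. by rewrite /adj map_mx1 trmx1. Qed.

Lemma adj0 m p : adj (0 : 'M[C]_(m, p)) = 0.
Proof. by rewrite /adj map_mx0 trmx0. Qed.

Lemma adj_sum (I : Type) (r : seq I) (P : pred I) m p (F : I -> 'M[C]_(m, p)) :
  adj (\sum_(i <- r | P i) F i) = \sum_(i <- r | P i) adj (F i).
Proof. by apply: (big_morph (@adj R m p)); [exact: adjD | exact: adj0]. Qed.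

Lemma adj_col_mx m1 m2 p (M : 'M[C]_(m1, p)) (N : 'M[C]_(m2, p)) :
  adj (col_mx M N) = row_mx (adj M) (adj N).
Proof. by rewrite /adj map_col_mx tr_col_mx. Qed.

Lemma adj_delta m p (i : 'I_m) (j : 'I_p) :
  adj (delta_mx i j : 'M[C]_(m, p)) = delta_mx j i.
Proof. by rewrite /adj map_delta_mx trmx_delta. Qed.

Lemma mxtrace_adj m (M : 'M[C]_m) : \tr (adj M) = (\tr M)^*.
Proof. by rewrite /adj mxtrace_tr /mxtrace rmorph_sum; apply: eq_bigr => i _; rewrite mxE. Qed.

(** The diagonal entry [j] of [adj M *m M] is the squared norm of column [j] of [M]. *)
Lemma adj_mulmx_eq0 m p (M : 'M[C]_(m, p)) : adj M *m M = 0 -> M = 0.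
Proof.
move=> MM0; apply/matrixP => i j; rewrite mxE.
have /matrixP/(_ j j) := MM0; rewrite !mxE => /eqP.
rewrite psumr_eq0 => [/allP/(_ i)|k _]; last first.
  by rewrite !mxE mulrC mul_conjC_ge0.
by rewrite mem_index_enum !mxE mulrC mul_conjC_eq0 => /(_ isT)/eqP.
Qed.

Lemma psd_congr m p (M : 'M[C]_m) (N : 'M[C]_(m, p)) :
  psd M -> psd (adj N *m M *m N).
Proof. by move=> Mpsd v; have := Mpsd (N *m v); rewrite adjM !mulmxA. Qed.

Lemma psd1 m : psd (1%:M : 'M[C]_m).
Proof.
move=> v; rewrite mulmx1 mxE sumr_ge0 // => i _.
by rewrite !mxE mulrC mul_conjC_ge0.
Qed.

Lemma psd_gram m p (N : 'M[C]_(m, p)) : psd (adj N *m N).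
Proof. by rewrite -[adj N]mulmx1; apply/psd_congr/psd1. Qed.

Lemma psdD m (M N : 'M[C]_m) : psd M -> psd N -> psd (M + N).
Proof. by move=> HM HN v; rewrite mulmxDr mulmxDl mxE addr_ge0 ?HM ?HN. Qed.

Lemma psd0 m : psd (0 : 'M[C]_m).
Proof. by move=> v; rewrite mulmx0 mul0mx mxE. Qed.

Lemma psdZ m (a : C) (M : 'M[C]_m) : 0 <= a -> psd M -> psd (a *: M).
Proof. by move=> a0 HM v; rewrite -scalemxAr -scalemxAl mxE mulr_ge0 ?HM. Qed.

Lemma psd_sum (I : Type) (r : seq I) (P : pred I) m (F : I -> 'M[C]_m) :
  (forall i, P i -> psd (F i)) -> psd (\sum_(i <- r | P i) F i).
Proof.
by move=> HF; elim/big_ind: _ => //; [exact: psd0 | exact: psdD].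
Qed.

Lemma psd_trace_ge0 m (M : 'M[C]_m) : psd M -> 0 <= \tr M.
Proof.
move=> HM; rewrite sumr_ge0 // => i _.
have := HM (delta_mx i 0).
by rewrite adj_delta -rowE -colE !mxE.
Qed.

(** Complex polarization: testing on [u i + c *: u j] with [c = 1] gives [D i j = - D j i], and with
    [c = 'i] gives [D i j = D j i]. *)
Lemma quadratic_form_eq0 m (D : 'M[C]_m) :
  (forall v : 'cV[C]_m, (adj v *m D *m v) 0 0 = 0) -> D = 0.
Proof.
move=> D0.
pose u i : 'cV[C]_m := delta_mx i 0.
pose B i j := (adj (u i) *m D *m u j) 0 0.
have BE i j : B i j = D i j.
  by rewrite /B adj_delta -rowE -colE !mxE.
have DE (c : C) i j : c * D i j + c^* * D j i = 0.
  have := D0 (u i + c *: u j).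
  rewrite adjD adj_scalemx !(mulmxDl, mulmxDr) -!(scalemxAl, scalemxAr).
  rewrite ![(_ + _ : 'M_1) 0 0]mxE ![(_ *: _ : 'M_1) 0 0]mxE !D0.
  by rewrite -!/(B _ _) !BE !mulr0 addr0 add0r addrC.
apply/matrixP => i j; rewrite [RHS]mxE.
have := DE 1 i j; have := DE 'i i j.
rewrite conjCi conjC1 !mul1r mulNr => /eqP; rewrite subr_eq0 => /eqP.
move=> /(mulfI (neq0Ci _)) <- /eqP.
by rewrite -mulr2n mulrn_eq0 /= => /eqP.
Qed.

(** Since [0 <= z] in C forces [z] to be real, the quadratic form of [M] equals its conjugate, which
    is the form of [adj M]; their difference then vanishes by polarization. *)
Lemma psd_hermitian m (M : 'M[C]_m) : psd M -> adj M = M.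
Proof.
move=> HM; apply/eqP; rewrite -subr_eq0; apply/eqP.
apply: quadratic_form_eq0 => v.
rewrite mulmxBr mulmxBl mxE [X in _ + X]mxE.
have /conj_Creal <- : (adj v *m M *m v) 0 0 \is Num.real.
  by rewrite realE HM.
apply/eqP; rewrite subr_eq0; apply/eqP.
have -> : adj v *m adj M *m v = adj (adj v *m M *m v).
  by rewrite !adjM adjK mulmxA.
by rewrite [LHS]mxE [LHS]mxE.
Qed.

Lemma psd_spectral m (M : 'M[C]_m) : psd M ->
  exists (P : 'M[C]_m) (d : 'rV[C]_m),
    [/\ P *m adj P = 1%:M, adj P *m P = 1%:M, forall i, 0 <= d 0 i &
        M = adj P *m diag_mx d *m P].
Proof.
move=> HM; have Mh := psd_hermitian HM.
have Mn : M \is normalmx.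
  by apply/normalmxP; rewrite -map_trmx -/(adj M) Mh.
move/orthomx_spectralP: Mn; set P := spectralmx M; set d := spectral_diag M.
have Pu : P \is unitarymx by exact: spectral_unitarymx.
have PE : invmx P = adj P by rewrite invmx_unitary // /adj map_trmx.
have PP : P *m adj P = 1%:M by rewrite -PE mulmxV // spectral_unit.
have PP' : adj P *m P = 1%:M by rewrite -PE mulVmx // spectral_unit.
rewrite PE => ME; exists P, d; split => // i.
(* Column [i] of [adj P] is an eigenvector for [d 0 i], so testing positivity on it isolates that
   eigenvalue. *)
have := HM (adj P *m delta_mx i 0).
rewrite adjM adjK adj_delta.
rewrite {1}ME !mulmxA -[X in X *m _ *m P]mulmxA PP mulmx1.
rewrite -[X in (X *m _) 0 0]mulmxA PP mulmx1.
by rewrite -rowE -colE !mxE eqxx.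
Qed.

Lemma psd_diag m (d : 'rV[C]_m) : (forall i, 0 <= d 0 i) -> psd (diag_mx d).
Proof.
move=> d0 v; rewrite mul_mx_diag mxE sumr_ge0 // => i _.
by rewrite !mxE mulrAC [_ * v i 0]mulrC mulr_ge0 // mul_conjC_ge0.
Qed.

Lemma psd_sqrt_exists m (M : 'M[C]_m) : psd M -> exists S, psd S /\ S *m S = M.
Proof.
move=> /psd_spectral[P [d [PP PP' d0 ->]]].
exists (adj P *m diag_mx (\row_i sqrtC (d 0 i)) *m P); split.
  by apply/psd_congr/psd_diag => i; rewrite mxE sqrtC_ge0.
rewrite !mulmxA -[X in X *m _ *m P]mulmxA PP mulmx1.
rewrite -[X in X *m P]mulmxA mulmx_diag; congr (_ *m diag_mx _ *m _).
by apply/rowP => i; rewrite !mxE -expr2 sqrtCK.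
Qed.

Lemma psd_sqrtP m (M : 'M[C]_m) :
  psd M -> psd (psd_sqrt M) /\ psd_sqrt M *m psd_sqrt M = M.
Proof. by move=> /psd_sqrt_exists; apply: epsilon_spec. Qed.

(* Moore-Penrose inverse, inverting the nonzero eigenvalues (and using 0^-1 = 0). *)
Lemma psd_pinv m (M : 'M[C]_m) : psd M ->
  exists Q, [/\ adj Q = Q, M *m Q = Q *m M & M *m Q *m M = M].
Proof.
move=> /psd_spectral[P [d [PP PP' d0 ->]]].
pose Q := adj P *m diag_mx (\row_i (d 0 i)^-1) *m P.
exists Q; split.
- apply: psd_hermitian; apply/psd_congr/psd_diag => i.
  by rewrite mxE invr_ge0.
- rewrite /Q !mulmxA -![_ *m P *m adj P]mulmxA PP !mulmx1.
  by rewrite -![adj P *m _ *m _]mulmxA (diag_mxC d).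
rewrite /Q !mulmxA -![_ *m P *m adj P]mulmxA PP !mulmx1.
rewrite -![adj P *m _ *m _]mulmxA !mulmx_diag; congr (_ *m (_ *m _)).
congr diag_mx; apply/rowP => i; rewrite !mxE.
have [->|di] := eqVneq (d 0 i) 0; first by rewrite !mul0r.
by rewrite divff ?mul1r.
Qed.

(** With [M = S *m S] and [S] Hermitian, the congruence is the Gram matrix of [S *m N]. *)
Lemma psd_congr_eq0 m p (M : 'M[C]_m) (N : 'M[C]_(m, p)) :
  psd M -> adj N *m M *m N = 0 -> M *m N = 0.
Proof.
move=> /psd_sqrt_exists[S [/psd_hermitian Sh <-]] NSSN.
have SN0 : S *m N = 0.
  by apply: adj_mulmx_eq0; rewrite adjM Sh -[RHS]NSSN !mulmxA.
by rewrite -mulmxA SN0 mulmx0.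
Qed.

Lemma psd_block_dr m p (A : 'M[C]_m) (X : 'M[C]_(m, p)) Y (B : 'M[C]_p) :
  psd (block_mx A X Y B) -> psd B.
Proof.
move=> /(psd_congr (col_mx 0 1%:M)).
rewrite adj_col_mx adj_idmx adj0 mul_row_block mul_row_col.
by rewrite !mul1mx !mul0mx !add0r mulmx1 mulmx0 add0r.
Qed.

(** On [col_mx 0 N] the form of the block matrix reduces to that of [B] and vanishes, so by
    [psd_congr_eq0] the whole block matrix kills it; the upper component is [X *m N]. *)
Lemma psd_block_ker_dr m p q (A : 'M[C]_m) (X : 'M[C]_(m, p)) Y (B : 'M[C]_p)
    (N : 'M[C]_(p, q)) :
  psd (block_mx A X Y B) -> B *m N = 0 -> X *m N = 0.
Proof.
move=> Hpsd BN0.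
have := @psd_congr_eq0 _ _ _ (col_mx 0 N) Hpsd.
rewrite mul_block_col -mulmxA mul_block_col BN0 !mulmx0 !add0r.
rewrite adj_col_mx mul_row_col adj0 mul0mx mulmx0 addr0 => /(_ erefl)/eqP.
by rewrite col_mx_eq0 => /andP[/eqP].
Qed.

Lemma psd_block_ker_ul m p q (A : 'M[C]_m) (X : 'M[C]_(m, p)) Y (B : 'M[C]_p)
    (N : 'M[C]_(m, q)) :
  psd (block_mx A X Y B) -> A *m N = 0 -> Y *m N = 0.
Proof.
move=> Hpsd AN0.
have := @psd_congr_eq0 _ _ _ (col_mx N 0) Hpsd.
rewrite mul_block_col -mulmxA mul_block_col AN0 !mulmx0 !addr0.
rewrite adj_col_mx mul_row_col adj0 mul0mx mulmx0 addr0 => /(_ erefl)/eqP.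
by rewrite col_mx_eq0 => /andP[_ /eqP].
Qed.

End PositiveMatrices.

(** * Fidelity as a block-positivity optimum *)

Section RealPart.
Variable R : realType.
Local Notation C := R[i].

Lemma complexRe_conj (z : C) : complex.Re z^* = complex.Re z.
Proof. by case: z. Qed.

Lemma complexReD (y z : C) : complex.Re (y + z) = complex.Re y + complex.Re z.
Proof. by case: y z => [a b] [c d]. Qed.

Lemma complexReN (z : C) : complex.Re (- z) = - complex.Re z.
Proof. by case: z. Qed.

Lemma complexRe_ge0 (z : C) : 0 <= z -> 0 <= complex.Re z.
Proof. by rewrite lecE => /andP[]. Qed.

Lemma complexRe_natV n (z : C) : complex.Re (n%:R^-1 * z) = n%:R^-1 * complex.Re z.
Proof.
have -> : n%:R^-1 = (n%:R^-1)%:C%C :> C by rewrite fmorphV rmorph_nat.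
by case: z => a b /=; rewrite mul0r subr0.
Qed.

Lemma complexRe_sum (I : Type) (r : seq I) (F : I -> C) :
  complex.Re (\sum_(i <- r) F i) = \sum_(i <- r) complex.Re (F i).
Proof. by apply: (big_morph (@complex.Re R)); [exact: complexReD|]. Qed.

Lemma Re_half_tr_adj m (X : 'M[C]_m) :
  complex.Re (2^-1 * \tr (X + adj X)) = complex.Re (\tr X).
Proof.
rewrite complexRe_natV mxtraceD mxtrace_adj complexReD complexRe_conj -mulr2n -[complex.Re _ *+ 2]mulr_natl.
by rewrite mulKf ?pnatr_eq0.
Qed.

End RealPart.

Section Fidelity.
Variable R : realType.
Local Notation C := R[i].

(** Hides the two epsilon-chosen roots behind their defining equations. *)
Lemma fidelity_sqrtP m (rho sigma : 'M[C]_m) : psd rho -> psd sigma ->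
  exists S T : 'M[C]_m,
    [/\ psd S, S *m S = rho, psd T, T *m T = S *m sigma *m S
      & fidelity rho sigma = complex.Re (\tr T)].
Proof.
move=> /psd_sqrtP[Spsd SS] sigma_psd.
set S := psd_sqrt rho in Spsd SS *.
have /psd_sqrtP[Tpsd TT] : psd (S *m sigma *m S).
  by rewrite -{1}(psd_hermitian Spsd); apply: psd_congr.
by exists S, (psd_sqrt (S *m sigma *m S)); split.
Qed.

(* Weak duality, tested on the dual witness [S^-1 T S^-1], [S T^-1 S] where
   S = sqrt rho and T = sqrt (S sigma S); pseudo-inverses suffice because X
   vanishes on the kernels of rho and sigma. *)
Lemma fidelity_ge_block m (rho sigma X : 'M[C]_m) : psd rho ->
  psd (block_mx rho X (adj X) sigma) ->
  complex.Re (\tr X) <= fidelity rho sigma.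
Proof.
move=> rho_psd Bpsd; have sigma_psd := psd_block_dr Bpsd.
have [S [T [Spsd SS Tpsd TT ->]]] := fidelity_sqrtP rho_psd sigma_psd.
have Sh := psd_hermitian Spsd; have Th := psd_hermitian Tpsd.
have [G [Gh SG SGS]] := psd_pinv Spsd.
have [H [Hpsd HH]] := psd_sqrt_exists Tpsd.
have Hh := psd_hermitian Hpsd.
have [K [Kh HK HKH]] := psd_pinv Hpsd.
have SSG : S *m S *m G = S by rewrite -mulmxA SG mulmxA.
have HHK : H *m H *m K = H by rewrite -mulmxA HK mulmxA.
have SP : S *m (S *m G - 1%:M) = 0 by rewrite mulmxBr mulmx1 mulmxA SSG subrr.
(* [S *m G] projects onto the range of [S]. As [T *m T = S *m sigma *m S] kills [S *m G - 1%:M], so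
   does [T]. *)
have TG : T *m (S *m G) = T.
  apply/eqP; rewrite -subr_eq0 -{2}[T]mulmx1 -mulmxBr; apply/eqP.
  apply: adj_mulmx_eq0; rewrite adjM Th -mulmxA (mulmxA T) TT.
  by rewrite -(mulmxA _ S) SP !mulmx0.
(* [rho] kills [S *m G - 1%:M], hence block positivity makes [adj X] kill it as well; then take
   adjoints. *)
have XSG : S *m G *m X = X.
  have : adj X *m (S *m G - 1%:M) = 0.
    apply: (psd_block_ker_ul Bpsd).
    by rewrite -SS -mulmxA SP mulmx0.
  move/(congr1 (@adj _ _ _)); rewrite adjM adjK adjB adj_idmx adjM Gh Sh adj0.
  by rewrite mulmxBl mul1mx -SG => /eqP; rewrite subr_eq0 => /eqP.
have TP : T *m (H *m K - 1%:M) = 0.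
  by rewrite mulmxBr mulmx1 -HH -!mulmxA (mulmxA H H K) HHK subrr.
(* [H *m K] projects onto the range of [T]. On its complement the form of [S *m sigma *m S]
   vanishes, so [sigma *m S] and, by block positivity, [X *m S] vanish there too. *)
have XSE : X *m S *m (H *m K) = X *m S.
  apply/eqP; rewrite -subr_eq0 -{2}[S]mulmx1 -!mulmxA -!mulmxBr; apply/eqP.
  apply: (psd_block_ker_dr Bpsd); apply: (psd_congr_eq0 sigma_psd).
  have -> (N : 'M[C]_m) : adj (S *m N) *m sigma *m (S *m N) =
      adj N *m (S *m sigma *m S) *m N by rewrite adjM Sh !mulmxA.
  by rewrite -TT -!mulmxA TP !mulmx0.
(* With [H] a root of [T], the dual witnesses factor as [G *m H] and [S *m K] times their adjoints.
   The four blocks contribute [\tr T], minus [\tr X], minus its conjugate, and [\tr T]. *)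
have : 0 <= \tr (adj (col_mx (G *m H) (- (S *m K))) *m
    block_mx rho X (adj X) sigma *m col_mx (G *m H) (- (S *m K))).
  exact/psd_trace_ge0/psd_congr.
rewrite -mulmxA mul_block_col adj_col_mx mul_row_col !adjN !adjM Gh Hh Sh Kh.
rewrite !(mulmxDr, mulmxN, mulNmx) opprK !mxtraceD !raddfN /=.
have -> : \tr (H *m G *m (rho *m (G *m H))) = \tr T.
  have -> : H *m G *m (rho *m (G *m H)) = H *m (G *m S *m (S *m G) *m H).
    by rewrite -SS !mulmxA.
  rewrite -SG (mulmxA (S *m G)) SGS mxtrace_mulC -(mulmxA _ H H) HH mxtrace_mulC.
  by rewrite TG.
have tX : \tr (H *m G *m (X *m (S *m K))) = \tr X.
  rewrite -mulmxA mxtrace_mulC -!mulmxA -HK (mulmxA X) XSE.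
  by rewrite mxtrace_mulC -mulmxA mxtrace_mulC XSG.
have -> : \tr (K *m S *m (adj X *m (G *m H))) = (\tr X)^*.
  by rewrite -tX -mxtrace_adj !adjM Gh Hh Sh Kh !mulmxA.
have -> : \tr (K *m S *m (sigma *m (S *m K))) = \tr T.
  have -> : K *m S *m (sigma *m (S *m K)) = K *m (S *m sigma *m S) *m K.
    by rewrite !mulmxA.
  rewrite -TT -{1}HH -HH !mulmxA -HK HKH -!mulmxA (mulmxA H H K) HHK.
  by [].
move/complexRe_ge0; rewrite !(complexReD, complexReN) complexRe_conj tX [- _ + _]addrC addrACA -opprD.
by rewrite -!mulr2n subr_ge0 lerMn2r.
Qed.

(* The optimal X is [sqrt rho * T^-1 * sqrt rho * sigma], with
   T = sqrt (sqrt rho * sigma * sqrt rho) pseudo-inverted. *)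
Lemma fidelity_block_attained m (rho sigma : 'M[C]_m) : psd rho -> psd sigma ->
  exists2 X : 'M[C]_m, psd (block_mx rho X (adj X) sigma) &
    complex.Re (\tr X) = fidelity rho sigma.
Proof.
move=> rho_psd sigma_psd.
have [S [T [Spsd SS Tpsd TT ->]]] := fidelity_sqrtP rho_psd sigma_psd.
have Sh := psd_hermitian Spsd; have Th := psd_hermitian Tpsd.
have sigh := psd_hermitian sigma_psd.
have [Q [Qh TQ TQT]] := psd_pinv Tpsd.
have TTQ : T *m T *m Q = T by rewrite -mulmxA TQ mulmxA.
pose Z := S *m Q *m S.
have Zh : adj Z = Z by rewrite /Z !adjM Sh Qh mulmxA.
have ZsZ : Z *m sigma *m Z = S *m (Q *m T) *m S.
  have -> : Z *m sigma *m Z = S *m Q *m (S *m sigma *m S) *m Q *m S.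
    by rewrite /Z !mulmxA.
  by rewrite -TT -(mulmxA _ (T *m T)) TTQ !mulmxA.
exists (Z *m sigma); last first.
  rewrite /Z -!mulmxA mxtrace_mulC -!mulmxA (mulmxA S) -TT mxtrace_mulC.
  by rewrite TTQ.
have Ph : adj (1%:M - Q *m T) = 1%:M - Q *m T.
  by rewrite adjB adj_idmx adjM Qh Th TQ.
have PP : (1%:M - Q *m T) *m (1%:M - Q *m T) = 1%:M - Q *m T.
  rewrite mulmxBr mulmx1 mulmxBl mul1mx -!mulmxA.
  by rewrite (mulmxA T) TQT subrr subr0.
(* The first summand has upper left block [Z *m sigma *m Z = S *m (Q *m T) *m S]. Its defect from
   [rho] is [S *m (1%:M - Q *m T) *m S], a Gram matrix since [1%:M - Q *m T] is an orthogonal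
   projection. *)
have -> : block_mx rho (Z *m sigma) (adj (Z *m sigma)) sigma =
  adj (row_mx Z 1%:M) *m sigma *m row_mx Z 1%:M +
  adj (row_mx ((1%:M - Q *m T) *m S) 0) *m row_mx ((1%:M - Q *m T) *m S) 0.
  have adj_row p q (M : 'M[C]_(m, p)) (N : 'M[C]_(m, q)) :
      adj (row_mx M N) = col_mx (adj M) (adj N).
    by rewrite /adj map_row_mx tr_row_mx.
  rewrite !adj_row Zh adj_idmx adj0 !mul_col_mx !mul_mx_row.
  rewrite -!/(block_mx _ _ _ _) add_block_mx !mulmx0 !mul0mx !addr0.
  rewrite !mul1mx !mulmx1 adjM Zh sigh adjM Ph Sh ZsZ.
  congr block_mx.
  rewrite -(mulmxA S _ (_ *m S)) (mulmxA (1%:M - Q *m T)) PP mulmxBl mul1mx mulmxBr SS.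
  by rewrite !mulmxA [RHS]addrC subrK.
by apply: psdD; [exact: psd_congr | exact: psd_gram].
Qed.

End Fidelity.

(** * Operators and Choi matrices *)

Section Operators.
Variable R : realType.
Local Notation C := R[i].
Local Notation Op := (Op R).

Lemma ent_mkop (T : finType) (f : T -> T -> C) x y : ent (mkop f) x y = f x y.
Proof. by rewrite /ent mxE !enum_rankK. Qed.

Lemma op_ext (T : finType) (M N : Op T) :
  (forall x y, ent M x y = ent N x y) -> M = N.
Proof.
move=> MN; apply/matrixP => i j.
by have := MN (enum_val i) (enum_val j); rewrite /ent !enum_valK.
Qed.

Lemma entD (T : finType) (M N : Op T) x y : ent (M + N) x y = ent M x y + ent N x y.
Proof. by rewrite /ent mxE. Qed.

Lemma entZ (T : finType) (a : C) (M : Op T) x y : ent (a *: M) x y = a * ent M x y.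
Proof. by rewrite /ent mxE. Qed.

Lemma ent_sum (I : Type) (r : seq I) (P : pred I) (T : finType) (F : I -> Op T) x y :
  ent (\sum_(i <- r | P i) F i) x y = \sum_(i <- r | P i) ent (F i) x y.
Proof. by rewrite /ent summxE. Qed.

Lemma ent1 (T : finType) (x y : T) : ent (1%:M : Op T) x y = (x == y)%:R.
Proof. by rewrite /ent mxE (inj_eq enum_rank_inj). Qed.

Lemma ent_adj (T : finType) (M : Op T) x y : ent (adj M) x y = (ent M y x)^*.
Proof. by rewrite /ent !mxE. Qed.

Lemma sum_enum_rank (V : nmodType) (T : finType) (F : 'I_#|T| -> V) :
  \sum_i F i = \sum_(x : T) F (enum_rank x).
Proof.
rewrite (reindex enum_rank) //.
by exists enum_val => i _; rewrite ?enum_rankK ?enum_valK.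
Qed.

Lemma ent_mul (T : finType) (M N : Op T) x z :
  ent (M *m N) x z = \sum_y ent M x y * ent N y z.
Proof. by rewrite /ent mxE sum_enum_rank. Qed.

Lemma tr_ent (T : finType) (M : Op T) : \tr M = \sum_x ent M x x.
Proof. by rewrite /mxtrace sum_enum_rank. Qed.

Lemma sum_delta (T : finType) (F : T -> C) (a : T) :
  \sum_x (x == a)%:R * F x = F a.
Proof.
rewrite (bigD1 a) //= eqxx mul1r big1 ?addr0 // => x /negbTE ->.
by rewrite mul0r.
Qed.

Lemma psd_mkop_gram (I T : finType) (w : I -> T -> C) :
  psd (mkop (fun x y => \sum_i (w i x)^* * w i y)).
Proof.
have -> : mkop (fun x y => \sum_i (w i x)^* * w i y) =
    \sum_i adj (\row_k w i (enum_val k)) *m (\row_k w i (enum_val k)).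
  apply/matrixP => k l; rewrite !mxE summxE; apply: eq_bigr => i _.
  by rewrite !mxE big_ord1 !mxE.
by apply: psd_sum => i _; exact: psd_gram.
Qed.

(** Converse of [psd_mkop_gram], with the rows of a square root as [w]. Through this pair,
    positivity is handled on labelled entries. *)
Lemma psd_gramP (T : finType) (M : Op T) : psd M ->
  exists w : T -> T -> C, forall x y, ent M x y = \sum_c (w c x)^* * w c y.
Proof.
move=> /psd_sqrt_exists[S [/psd_hermitian Sh <-]].
exists (fun c x => ent S c x) => x y.
by rewrite ent_mul -{1}Sh; apply: eq_bigr => c _; rewrite ent_adj.
Qed.

(** A Gram family precomposed with any [f] is again one; this covers both principal submatrices and
    permutations of labels. *)
Lemma psd_reidx (T T' : finType) (f : T' -> T) (M : Op T) :
  psd M -> psd (reidx f M).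
Proof.
move=> /psd_gramP[w Mw].
have -> : reidx f M = mkop (fun x y => \sum_c (w c (f x))^* * w c (f y)).
  by apply: op_ext => x y; rewrite !ent_mkop.
exact: (psd_mkop_gram (fun c x => w c (f x))).
Qed.

End Operators.

Section Choi.
Variables (R : realType) (A A' : finType).
Local Notation C := R[i].
Local Notation Op := (Op R).

(** This is [tr_A (J^{T_A} M)] in entries: the partial transpose aligns the indices [a], [b] of [M]
    with those of [J]. *)
Definition choi_map (J : Op (A * A')%type) (M : Op A) : Op A' :=
  mkop (fun x y => \sum_a \sum_b ent M a b * ent J (a, x) (b, y)).

Lemma choi_map_is_linear J : linear (choi_map J).
Proof.
move=> c M N; apply: op_ext => x y; rewrite entD entZ !ent_mkop.
rewrite mulr_sumr -big_split; apply: eq_bigr => a _ /=.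
rewrite mulr_sumr -big_split; apply: eq_bigr => b _ /=.
by rewrite entD entZ mulrDl mulrA.
Qed.

HB.instance Definition _ J :=
  GRing.isLinear.Build C (Op A) (Op A') _ (choi_map J) (choi_map_is_linear J).

Definition choi (L : Op A -> Op A') : Op (A * A')%type :=
  mkop (fun x y => ent (L (mkop (fun c d => ((c == x.1) && (d == y.1))%:R))) x.2 y.2).

(** Expand [M] in the matrix units [E a b] and use linearity of [L]. *)
Lemma choi_mapK (L : {linear Op A -> Op A'}) M : choi_map (choi L) M = L M.
Proof.
pose E a b : Op A := mkop (fun c d => ((c == a) && (d == b))%:R).
have {2}-> : M = \sum_a \sum_b ent M a b *: E a b.
  apply: op_ext => x y; rewrite ent_sum.
  under eq_bigr => a _.
    rewrite ent_sum.
    under eq_bigr => b _ do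
      rewrite entZ ent_mkop (eq_sym y) mulrC -mulnb natrM [_%:R * _%:R]mulrC -mulrA.
    rewrite (sum_delta (fun b => (x == a)%:R * ent M a b)) eq_sym.
    over.
  by rewrite (sum_delta (fun a => ent M a y)).
apply: op_ext => x y; rewrite ent_mkop linear_sum ent_sum.
apply: eq_bigr => a _; rewrite linear_sum ent_sum; apply: eq_bigr => b _.
by rewrite linearZ entZ ent_mkop.
Qed.

Lemma ent_app_choi (K : finType) J (M : Op (A * K)%type) x y :
  ent (app_id (choi_map J) M) x y =
  \sum_a \sum_b ent M (a, x.2) (b, y.2) * ent J (a, x.1) (b, y.1).
Proof.
rewrite !ent_mkop; apply: eq_bigr => a _; apply: eq_bigr => b _.
by rewrite ent_mkop.
Qed.

(** If [M] and [J] are Gram with families [w] and [u], the output is Gram with the family of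
    contractions of [w] and [u] over [A], indexed by pairs. *)
Lemma app_choi_psd (K : finType) J (M : Op (A * K)%type) :
  psd J -> psd M -> psd (app_id (choi_map J) M).
Proof.
move=> /psd_gramP[u Ju] /psd_gramP[w Mw].
have -> : app_id (choi_map J) M = mkop (fun x y : A' * K =>
    \sum_(i : (A * K) * (A * A'))
      (\sum_a w i.1 (a, x.2) * u i.2 (a, x.1))^* *
      (\sum_a w i.1 (a, y.2) * u i.2 (a, y.1))).
  apply: op_ext => x y; rewrite ent_app_choi ent_mkop.
  under [RHS]eq_bigr => i _ do rewrite rmorph_sum mulr_suml.
  rewrite [RHS]exchange_big; apply: eq_bigr => a _ /=.
  under [RHS]eq_bigr => i _ do rewrite mulr_sumr.
  rewrite [RHS]exchange_big; apply: eq_bigr => b _ /=.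
  rewrite Mw Ju big_distrlr pair_bigA; apply: eq_bigr => -[c d] _ /=.
  by rewrite rmorphM mulrACA.
exact: (psd_mkop_gram (fun (i : (A * K) * (A * A')) (x : A' * K) =>
  \sum_a w i.1 (a, x.2) * u i.2 (a, x.1))).
Qed.

Lemma choi_map_channel (J : Op (A * A')%type) :
  psd J -> ptr2 J = 1%:M -> channel (choi_map J).
Proof.
move=> Jpsd Jtr; split=> [k M Mpsd|M]; first exact: app_choi_psd.
rewrite !tr_ent; under eq_bigr => x _ do rewrite ent_mkop.
rewrite exchange_big; apply: eq_bigr => a _ /=.
rewrite exchange_big /=.
have Jab b : \sum_x ent J (a, x) (b, x) = (b == a)%:R.
  by have := congr1 (fun N => ent N a b) Jtr; rewrite /ptr2 ent_mkop ent1 eq_sym.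
under eq_bigr => b _ do rewrite -mulr_sumr Jab mulrC.
by rewrite (sum_delta (fun b => ent M a b)).
Qed.

Lemma choi_ptr2 (L : {linear Op A -> Op A'}) :
  channel L -> ptr2 (choi L) = 1%:M.
Proof.
move=> [_ Ltr]; apply: op_ext => a b; rewrite ent_mkop ent1.
under eq_bigr => x _ do rewrite ent_mkop /=.
rewrite -tr_ent Ltr tr_ent.
under eq_bigr => x _ do rewrite ent_mkop -mulnb natrM.
by rewrite (sum_delta (fun x => (x == b)%:R)).
Qed.

End Choi.

(** [channel] quantifies over ancillas ['I_k], whence the input system ['I_d]: the unnormalized
    maximally entangled operator [Om] lives on two copies of it, and its image under [L] tensor
    identity is the Choi operator with factors swapped. *)
Lemma choi_psd (R : realType) (d : nat) (A' : finType)
  (L : {linear Op R 'I_d -> Op R A'}) : channel L -> psd (choi L).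
Proof.
move=> [Lcp _].
(* The sum over [unit] puts this rank-one operator in the form of [psd_mkop_gram]. *)
pose Om : Op R ('I_d * 'I_d)%type :=
  mkop (fun x y => \sum_(i : unit) (((x.1 == x.2)%:R : R[i])^* * (y.1 == y.2)%:R)).
have Opsd : psd Om by exact: (psd_mkop_gram (fun _ x => (x.1 == x.2)%:R)).
have -> : choi L = reidx (fun s : 'I_d * A' => (s.2, s.1)) (app_id L Om).
  apply: op_ext => -[a x] [b y]; rewrite !ent_mkop /=; congr (ent (L _) _ _).
  apply: op_ext => c e; rewrite !ent_mkop /=.
  by rewrite big_const card_unit /= addr0 conjC_nat -natrM mulnb.
by apply: psd_reidx; apply: Lcp.
Qed.

(** * Symmetrized broadcasting *)

(** Translating by a transposition shows that the left sum does not depend on [j]; summing it over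
    all positions and exchanging sums gives the right side. *)
Lemma sum_perm_orbit (V : nmodType) n (F : 'I_n -> V) j :
  (\sum_(pi : 'S_n) F (pi j)) *+ n = (\sum_i F i) *+ n`!.
Proof.
have indep i : \sum_(pi : 'S_n) F (pi i) = \sum_(pi : 'S_n) F (pi j).
  rewrite (reindex_inj (mulgI (tperm i j))) /=.
  by apply: eq_bigr => pi _; rewrite permM tpermL.
transitivity (\sum_i \sum_(pi : 'S_n) F (pi i)).
  under [RHS]eq_bigr => i _ do rewrite indep.
  by rewrite sumr_const card_ord.
rewrite exchange_big /= -(card_Sn n) -sumr_const.
by apply: eq_bigr => pi _; rewrite [RHS](reindex_inj (@perm_inj _ pi)).
Qed.

Section Broadcast.
Variables (R : realType) (A B : finType) (n : nat).
Local Notation C := R[i].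
Local Notation Op := (Op R).
Local Notation An := (copies A n).

Lemma updK (g : An) j a b : upd (upd g j a) j b = upd g j b.
Proof. by apply/ffunP => i; rewrite !ffunE; case: eqP. Qed.

Lemma upd_id (g : An) j : upd g j (g j) = g.
Proof. by apply/ffunP => i; rewrite !ffunE; case: eqP => [->|]. Qed.

Lemma upd_eq (g : An) j a : upd g j a j = a.
Proof. by rewrite ffunE eqxx. Qed.

(* Freezing the j-th coordinate of the summation index at [a0] exhibits red_j
   as a sum of principal submatrices. *)
Lemma red_jE (a0 : A) j (M : Op (An * B)%type) :
  red_j j M = \sum_(g : An | g j == a0) reidx (fun x => (upd g j x.1, x.2)) M.
Proof.
apply: op_ext => x y; rewrite ent_mkop ent_sum.
rewrite (reindex_onto (fun g => upd g j x.1) (fun g => upd g j a0)) /=.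
  apply: eq_big => [g|g _]; last by rewrite ent_mkop updK.
  rewrite upd_eq eqxx updK /=.
  by apply/eqP/eqP => <-; [rewrite upd_eq | rewrite upd_id].
by move=> g /eqP <-; rewrite updK upd_id.
Qed.

Lemma red_j_psd (a0 : A) j (M : Op (An * B)%type) : psd M -> psd (red_j j M).
Proof.
by move=> Mpsd; rewrite (red_jE a0); apply: psd_sum => g _; exact: psd_reidx.
Qed.

(** The marginal is made a function of [J] so that linearity carries the average over permutations
    through it. *)
Definition broadcast_out (j : 'I_n) (rho : Op (A * B)%type)
    (J : Op (A * An)%type) : Op (A * B)%type :=
  red_j j (app_id (choi_map J) rho).

Lemma ent_broadcast_out j rho J x y :
  ent (broadcast_out j rho J) x y = \sum_(g : An | g j == x.1) \sum_a \sum_b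
    ent rho (a, x.2) (b, y.2) * ent J (a, g) (b, upd g j y.1).
Proof.
by rewrite ent_mkop; apply: eq_bigr => g _; rewrite ent_app_choi.
Qed.

Lemma broadcast_out_is_linear j rho : linear (broadcast_out j rho).
Proof.
move=> c J K; apply: op_ext => x y; rewrite entD entZ !ent_broadcast_out.
rewrite mulr_sumr -big_split; apply: eq_bigr => g _ /=.
rewrite mulr_sumr -big_split; apply: eq_bigr => a _ /=.
rewrite mulr_sumr -big_split; apply: eq_bigr => b _ /=.
by rewrite entD entZ mulrDr mulrCA.
Qed.

HB.instance Definition _ j rho := GRing.isLinear.Build C (Op (A * An)%type)
  (Op (A * B)%type) _ (broadcast_out j rho) (broadcast_out_is_linear j rho).

(** In entries, the identities on [B] and on the copies become Kronecker deltas, and what remains is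
    the Choi action on [rho]. *)
Lemma sdp_YE j J rho : sdp_Y j J rho = broadcast_out j rho J.
Proof.
rewrite /sdp_Y /broadcast_out; congr red_j; apply: op_ext => -[g b] [h b'].
rewrite ent_app_choi ent_mkop /= [RHS]exchange_big; apply: eq_bigr => a _ /=.
rewrite ent_mkop /= ent_mul.
transitivity (\sum_c \sum_k \sum_d (d == b)%:R * ((k == h)%:R *
    (ent rho (c, d) (a, b') * ent J (c, g) (a, k)))).
  rewrite pair_bigA pair_bigA; apply: eq_bigr => -[[c k] d] _ /=.
  rewrite !ent_mkop /= !ent1 (eq_sym b) mulrCA [RHS]mulrCA.
  by rewrite mulrC -!mulrA mulrCA mulrC -!mulrA mulrCA.
apply: eq_bigr => c _; rewrite exchange_big /=.
under eq_bigr => d _ do rewrite -mulr_sumr (sum_delta (fun k => _ * ent J (c, g) (a, k))).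
by rewrite (sum_delta (fun d => ent rho (c, d) (a, b') * _)).
Qed.

Definition permute_copies (pi : 'S_n) (J : Op (A * An)%type) : Op (A * An)%type :=
  reidx (fun s : A * An => (s.1, [ffun i => s.2 (pi i)] : An)) J.

(** Row [g] of [Wperm] has its only 1 in column [g] composed with [pi], so the inverse in [Wperm]
    turns into [pi] in [permute_copies]. *)
Lemma Wperm_conj pi (J : Op (A * An)%type) :
  tens (1%:M : Op A) (Wperm R A pi) *m J *m adj (tens (1%:M : Op A) (Wperm R A pi))
  = permute_copies pi J.
Proof.
pose f (s : A * An) : A * An := (s.1, [ffun i => s.2 (pi i)]).
have Wf x y : ent (tens (1%:M : Op A) (Wperm R A pi)) x y = (y == f x)%:R.
  case: x y => [a g] [b h]; rewrite !ent_mkop /= ent1 -natrM mulnb.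
  rewrite xpair_eqE (eq_sym a); congr ((_ && _)%:R).
  apply/eqP/eqP => ->; apply/ffunP => i; rewrite !ffunE.
    by rewrite permK.
  by rewrite permKV.
apply: op_ext => x y; rewrite ent_mul ent_mkop -/(f x) -/(f y).
under eq_bigr => z _ do
  rewrite ent_adj Wf conjC_nat ent_mul
    (eq_bigr _ (fun t _ => congr1 (fun u => u * ent J t z) (Wf x t)))
    (sum_delta (fun t => ent J t z)) mulrC.
by rewrite (sum_delta (fun z => ent J (f x) z)).
Qed.

Lemma permute_copies_psd pi J : psd J -> psd (permute_copies pi J).
Proof. exact: psd_reidx. Qed.

(** The group product applies its left factor first, hence the reversed order. *)
Lemma permute_copiesM pi tau J :
  permute_copies pi (permute_copies tau J) = permute_copies (tau * pi)%g J.
Proof.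
apply: op_ext => x y; rewrite !ent_mkop /=; congr (ent _ (_, _) (_, _));
  by apply/ffunP => i; rewrite !ffunE permM.
Qed.

Lemma permute_copies_is_linear pi : linear (permute_copies pi).
Proof. by move=> c J K; apply: op_ext => x y; rewrite !(entD, entZ, ent_mkop). Qed.

HB.instance Definition _ pi := GRing.isLinear.Build C (Op (A * An)%type)
  (Op (A * An)%type) _ (permute_copies pi) (permute_copies_is_linear pi).

Lemma copies_perm_inj (pi : 'S_n) :
  injective (fun g : An => [ffun i => g (pi i)] : An).
Proof.
move=> g h /ffunP gh; apply/ffunP => i.
by have := gh ((pi^-1)%g i); rewrite !ffunE permKV.
Qed.

Lemma ptr2_permute_copies pi J : ptr2 (permute_copies pi J) = ptr2 J.
Proof.
apply: op_ext => a b; rewrite !ent_mkop.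
rewrite [RHS](reindex_inj (@copies_perm_inj pi)) /=.
by apply: eq_bigr => g _; rewrite ent_mkop.
Qed.

Lemma ptr2_is_linear (T1 T2 : finType) : linear (@ptr2 R T1 T2).
Proof.
move=> c J K; apply: op_ext => x y; rewrite entD entZ !ent_mkop.
by rewrite mulr_sumr -big_split; apply: eq_bigr => b _ /=; rewrite entD entZ.
Qed.

HB.instance Definition _ (T1 T2 : finType) := GRing.isLinear.Build C
  (Op (T1 * T2)%type) (Op T1) _ (@ptr2 R T1 T2) (@ptr2_is_linear T1 T2).

(** Composing labels with [pi] moves coordinate [j] to position [(pi^-1)%g j], both in the summation
    constraint and in the updated label. *)
Lemma broadcast_out_permute j rho pi J :
  broadcast_out j rho (permute_copies pi J) = broadcast_out ((pi^-1)%g j) rho J.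
Proof.
apply: op_ext => x y; rewrite !ent_broadcast_out.
rewrite [RHS](reindex_inj (@copies_perm_inj pi)) /=.
apply: eq_big => [g|g _]; first by rewrite ffunE permKV.
apply: eq_bigr => a _; apply: eq_bigr => b _; rewrite ent_mkop /=.
congr (_ * ent _ _ (_, _)); apply/ffunP => i; rewrite !ffunE.
by rewrite (can2_eq (permK pi) (permKV pi)).
Qed.

Definition symmetrize (J : Op (A * An)%type) : Op (A * An)%type :=
  (n`!%:R)^-1 *: \sum_(pi : 'S_n) permute_copies pi J.

Lemma fact_neq0 : n`!%:R != 0 :> C.
Proof. by rewrite pnatr_eq0 -lt0n fact_gt0. Qed.

Lemma average_cst (V : lmodType C) (v : V) :
  (n`!%:R)^-1 *: \sum_(pi : 'S_n) v = v.
Proof.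
rewrite sumr_const card_Sn.
by rewrite -[v *+ _]scaler_nat scalerA mulVf ?scale1r ?fact_neq0.
Qed.

Lemma symmetrize_psd J : psd J -> psd (symmetrize J).
Proof.
move=> Jpsd; apply: psdZ; first by rewrite invr_ge0 ler0n.
by apply: psd_sum => pi _; exact: permute_copies_psd.
Qed.

Lemma permute_symmetrize pi J : permute_copies pi (symmetrize J) = symmetrize J.
Proof.
rewrite linearZ linear_sum /=; congr (_ *: _).
rewrite [RHS](reindex_inj (mulIg pi)) /=.
by apply: eq_bigr => tau _; rewrite permute_copiesM.
Qed.

(** This gives the symmetry constraint of the program for an averaged Choi operator. *)
Lemma symmetrize_id J : symmetrize (symmetrize J) = symmetrize J.
Proof.
rewrite {1}/symmetrize.
under eq_bigr => pi _ do rewrite permute_symmetrize.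
exact: average_cst.
Qed.

Lemma ptr2_symmetrize J : ptr2 (symmetrize J) = ptr2 J.
Proof.
rewrite linearZ linear_sum /=.
under eq_bigr => pi _ do rewrite ptr2_permute_copies.
exact: average_cst.
Qed.

Lemma broadcast_out_symmetrize j rho J : (0 < n)%N ->
  broadcast_out j rho (symmetrize J) =
  n%:R^-1 *: \sum_i broadcast_out i rho J.
Proof.
move=> n_gt0; rewrite linearZ linear_sum /=.
under eq_bigr => pi _ do rewrite broadcast_out_permute.
rewrite (reindex_inj invg_inj) /=.
under eq_bigr => pi _ do rewrite invgK.
have nz : n%:R != 0 :> C by rewrite pnatr_eq0 -lt0n.
(* Clearing both denominators leads to the division-free form of [sum_perm_orbit]. *)
apply: (scalerI fact_neq0); apply: (scalerI nz).
rewrite !scalerA (mulfK fact_neq0) mulrAC mulfV // mul1r.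
rewrite !scaler_nat; exact: (sum_perm_orbit (fun i => broadcast_out i rho J)).
Qed.

End Broadcast.

(** * Comparison of the two suprema *)

(** Mutual domination makes the downward closures equal, and passing to the downward closure
    preserves [sup]. *)
Lemma sup_cofinal (R : realType) (E F : set R) :
  (forall x, E x -> exists2 y, F y & x <= y) ->
  (forall y, F y -> exists2 x, E x & y <= x) -> sup E = sup F.
Proof.
move=> EF FE; rewrite -(sup_down E) -(sup_down F); congr sup.
apply/seteqP; split=> x [y].
  by case=> /EF[z Fz yz] xy; exists z; split=> //; exact: le_trans yz.
by case=> /FE[z Ez yz] xy; exists z; split=> //; exact: le_trans yz.
Qed.

Lemma block_mx_sum (V : nmodType) m1 m2 n1 n2 (I : Type) (r : seq I)
    (F : I -> 'M[V]_(m1, n1)) (G : I -> 'M[V]_(m1, n2))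
    (H : I -> 'M[V]_(m2, n1)) (K : I -> 'M[V]_(m2, n2)) :
  \sum_(i <- r) block_mx (F i) (G i) (H i) (K i) =
  block_mx (\sum_(i <- r) F i) (\sum_(i <- r) G i)
           (\sum_(i <- r) H i) (\sum_(i <- r) K i).
Proof.
elim: r => [|i r IH]; first by rewrite !big_nil block_mx0.
by rewrite !big_cons IH add_block_mx.
Qed.

Section Optimum.
Variables (R : realType) (dA dB n : nat).
Hypothesis n_gt0 : (0 < n)%N.
Local Notation C := R[i].
Local Notation A := 'I_dA.
Local Notation B := 'I_dB.

Variable rho : Op R (A * B)%type.
Hypothesis rho_state : is_state rho.

Let n_neq0 : n%:R != 0 :> C.
Proof. by rewrite pnatr_eq0 -lt0n. Qed.

(** Trace 1 excludes an empty label set; the label found anchors the sum in [red_j_psd]. *)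
Lemma state_inhabited : A.
Proof.
case: rho_state => _ tr1; case: dA rho tr1 => [|d] r tr1; last exact: ord0.
exfalso; have /eqP := tr1; rewrite tr_ent big1 => [|[[]]//].
by rewrite eq_sym oner_eq0.
Qed.

Lemma broadcast_le_sdp (j : 'I_n) (L : {linear Op R A -> Op R (copies A n)}) :
  channel L ->
  exists X J, sdp_feasible j rho X J /\
    complex.Re (2^-1 * \tr (X + adj X)) =
    n%:R^-1 * \sum_(i < n) fidelity rho (red_j i (app_id L rho)).
Proof.
move=> Lch; have rho_psd := rho_state.1.
have sig_psd i : psd (red_j i (app_id L rho)).
  by apply: red_j_psd state_inhabited _ _ _; apply: Lch.1.
have [X HX] : exists X : 'I_n -> Op R (A * B)%type, forall i,
    psd (block_mx rho (X i) (adj (X i)) (red_j i (app_id L rho))) /\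
    complex.Re (\tr (X i)) = fidelity rho (red_j i (app_id L rho)).
  apply: (fin_all_exists (P := fun i X => psd (block_mx rho X (adj X)
    (red_j i (app_id L rho))) /\
    complex.Re (\tr X) = fidelity rho (red_j i (app_id L rho)))) => i.
  by have [X Xpsd XF] := fidelity_block_attained rho_psd (sig_psd i); exists X.
have outE i : red_j i (app_id L rho) = broadcast_out i rho (choi L).
  congr red_j; apply: op_ext => x y.
  by rewrite [LHS]ent_mkop [RHS]ent_mkop choi_mapK.
exists (n%:R^-1 *: \sum_i X i), (symmetrize (choi L)); split.
  split; last first.
    have Jpsd : psd (symmetrize (choi L)) by apply/symmetrize_psd/choi_psd.
    split; first exact: psd_hermitian.
    split=> //; split; first by rewrite ptr2_symmetrize choi_ptr2.
    under eq_bigr => pi _ do rewrite Wperm_conj.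
    exact/esym/symmetrize_id.
  rewrite sdp_YE broadcast_out_symmetrize //.
  rewrite -(eq_bigr _ (fun i _ => outE i)).
  (* As [rho] is the mean of [n] copies of itself, the block matrix is a mean of [n] positive
     ones. *)
  have -> : block_mx rho (n%:R^-1 *: \sum_i X i) (adj (n%:R^-1 *: \sum_i X i))
      (n%:R^-1 *: \sum_i red_j i (app_id L rho)) =
    n%:R^-1 *: \sum_i block_mx rho (X i) (adj (X i)) (red_j i (app_id L rho)).
    rewrite block_mx_sum scale_block_mx; congr block_mx.
      by rewrite sumr_const card_ord -[rho *+ n]scaler_nat scalerA mulVf ?scale1r.
    by rewrite adj_scalemx adj_sum fmorphV rmorph_nat.
  by apply: psdZ; [rewrite invr_ge0 ler0n | apply: psd_sum => i _; case: (HX i)].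
rewrite Re_half_tr_adj linearZ /= complexRe_natV [\tr (\sum_i _)]linear_sum /= complexRe_sum.
by congr (_ * _); apply: eq_bigr => i _; case: (HX i).
Qed.

Lemma sdp_le_broadcast (j : 'I_n) X (J : Op R (A * copies A n)%type) :
  sdp_feasible j rho X J ->
  channel (choi_map J) /\
  complex.Re (2^-1 * \tr (X + adj X)) <=
  n%:R^-1 * \sum_(i < n) fidelity rho (red_j i (app_id (choi_map J) rho)).
Proof.
move=> [Bpsd [_ [Jpsd [Jtr Jsym]]]]; split; first exact: choi_map_channel.
have JE : symmetrize J = J.
  rewrite [RHS]Jsym /symmetrize; congr (_ *: _).
  by apply: eq_bigr => pi _; rewrite Wperm_conj.
(* Writing [J] as its own average turns each marginal into the mean of all of them, which is
   independent of [i]. *)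
have outE i : red_j i (app_id (choi_map J) rho) = sdp_Y j J rho.
  rewrite sdp_YE -[LHS]/(broadcast_out i rho J) -JE.
  by rewrite !broadcast_out_symmetrize.
under eq_bigr => i _ do rewrite outE.
rewrite sumr_const card_ord -[fidelity _ _ *+ n]mulr_natl mulKf ?pnatr_eq0 -?lt0n //.
by rewrite Re_half_tr_adj; exact: fidelity_ge_block rho_state.1 Bpsd.
Qed.

End Optimum.

Theorem theorem2 (R : realType) (dA dB n : nat) (hn : (0 < n)%N)
  (rho : Op R ('I_dA * 'I_dB)%type) :
  is_state rho ->
  broadcast_fid n rho = sdp_value (Ordinal hn) rho.
Proof.
move=> rho_state; apply: sup_cofinal => x.
  move=> [L [Lch ->]].
  have [X [J [feas XE]]] := broadcast_le_sdp hn rho_state (Ordinal hn) Lch.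
  by rewrite -XE; eexists; [exists X, J; split; [exact: feas | reflexivity] |].
(* A feasible [X] may be suboptimal for its [J], so here the channel only dominates the value. *)
move=> [X [J [feas ->]]].
have [Jch le] := sdp_le_broadcast hn rho_state feas.
by eexists; last exact: le; exists (choi_map J).
Qed.
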